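(* Let $a$ and $b$ be Laplacian strongly cospectral vertices of a graph $X$, and suppose $|\Phi_{ab}^-|=k$. Then every vertex at distance $k$ from $a$ is at distance at most $k$ from $b$. In particular, the distance between $a$ and $b$ is at most $2k$.
   Context: Let $L=D-A$ be the Laplacian of $X$ with spectral decomposition $L=\sum_r\mu_rF_r$ ($\mu_r$ the distinct eigenvalues, $F_r$ the orthogonal projection onto the $\mu_r$-eigenspace). Vertices $a,b$ are Laplacian strongly cospectral if $F_re_a=\pm F_re_b$ for every $r$. $\Phi_{ab}^-=\{\mu_r: F_re_a=-F_re_b\neq 0\}$. *)

(* Defs.v *)
From HB Require Import structures.
From mathcomp Require Import all_boot all_order all_algebra.
From mathcomp Require Import classical_sets cardinality reals.

Set Implicit Arguments.
Unset Strict Implicit.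
Unset Printing Implicit Defensive.

Import GRing.Theory Num.Theory.
Local Open Scope ring_scope.

Section Graph.
Variables (T : finType) (e : rel T).

Definition walk (x y : T) (n : nat) : Prop :=
  exists p : seq T, [/\ path e x p, last x p = y & size p = n].

(* Relational, so that vertices in different components have no distance. *)
Definition dist (x y : T) (d : nat) : Prop :=
  walk x y d /\ forall m, walk x y m -> (d <= m)%N.

Definition dist_le (x y : T) (k : nat) : Prop :=
  exists2 d, dist x y d & (d <= k)%N.

Variable R : realType.

(* Matrices are indexed by 'I_#|T|, identified with T by enum_val/enum_rank. *)
Definition adjacency : 'M[R]_#|T| :=
  \matrix_(i, j) (e (enum_val i) (enum_val j))%:R.

Definition degree : 'M[R]_#|T| :=
  diag_mx (\row_i #|[set y | e (enum_val i) y]|%:R).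

Definition laplacian : 'M[R]_#|T| := degree - adjacency.

Definition vertex_vec (x : T) : 'rV[R]_#|T| := delta_mx 0 (enum_rank x).

(* MathComp subspaces are row spaces and matrices act on row vectors from the
   right; the row space of kermx U^T is the orthogonal complement of that of U
   for the standard inner product. *)
Definition orthproj n (U : 'M[R]_n) : 'M[R]_n := proj_mx U (kermx U^T).

Definition eigenproj (mu : R) : 'M[R]_#|T| :=
  orthproj (eigenspace laplacian mu).

Definition laplacian_strongly_cospectral (a b : T) : Prop :=
  forall mu, eigenvalue laplacian mu ->
    vertex_vec a *m eigenproj mu = vertex_vec b *m eigenproj mu \/
    vertex_vec a *m eigenproj mu = - (vertex_vec b *m eigenproj mu).

Definition Phi_minus (a b : T) : set R :=
  [set mu | [/\ eigenvalue laplacian mu,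
      vertex_vec a *m eigenproj mu = - (vertex_vec b *m eigenproj mu) &
      vertex_vec a *m eigenproj mu != 0]]%classic.

End Graph.

(* Main.v *)
(* Let p be the monic polynomial of degree k with root set Phi_ab^-.  The vector
   e_a - e_b is orthogonal to every eigenspace of L outside Phi_ab^-, hence
   p(L) (e_a - e_b) is orthogonal to all eigenspaces and so vanishes.  If c is at
   distance k from a, then p(L)_{ca} is (-1)^k times the number of walks of length
   k from a to c; therefore p(L)_{cb} = p(L)_{ca} is nonzero, which gives a walk of
   length at most k from b to c.  Projecting e_a and e_b onto the kernel of L shows
   that a and b lie in the same component.  If they are more than k apart, apply
   the first part to the vertex at distance k from a on a geodesic to b. *)
Require Import Defs.
From HB Require Import structures.
From mathcomp Require Import all_boot all_order all_algebra.
From mathcomp Require Import complex.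
From mathcomp Require Import boolp classical_sets cardinality reals.

Set Implicit Arguments.
Unset Strict Implicit.
Unset Printing Implicit Defensive.

Import GRing.Theory Num.Theory.
Local Open Scope ring_scope.

(** * Real symmetric matrices have a real spectrum *)

Lemma mul_tr_eq0 (R : realDomainType) n (u : 'rV[R]_n) :
  u *m u^T = 0 -> u = 0.
Proof.
move=> /matrixP/(_ 0 0); rewrite !mxE => /eqP.
rewrite psumr_eq0 => [/allP u0|i _]; last by rewrite mxE -expr2 sqr_ge0.
apply/rowP => i; have := u0 i (mem_index_enum _).
by rewrite mxE mulf_eq0 orbb mxE => /eqP.
Qed.

(** Evaluating [u *m A *m v^T], with [v] the conjugate of [u], in two ways gives [z] and [z^*] times
    the same nonzero squared norm. *)
Lemma symmetric_eigenvalue_real (R : rcfType) n (L : 'M[R]_n) (z : R[i]) :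
  L^T = L -> eigenvalue (map_mx (real_complex R) L) z -> z \is Num.real.
Proof.
move=> Lsym /eigenvalueP[u uL u0].
set A := map_mx _ L in uL; pose v : 'rV_n := map_mx Num.conj u.
have vL : v *m A = z^* *: v.
  rewrite -(map_mxZ Num.conj) -uL map_mxM; congr (_ *m _).
  by apply/matrixP => i j; rewrite !mxE; apply/esym/CrealP; rewrite complex_real.
have Asym : A^T = A by apply/matrixP => i j; rewrite !mxE -{1}Lsym mxE.
have zuv : z *: (u *m v^T) = z^* *: (u *m v^T).
  rewrite scalemxAl -uL -mulmxA -{1}Asym -trmx_mul vL.
  by rewrite linearZ /= -scalemxAr.
rewrite CrealE; apply/eqP/esym; move/matrixP/(_ 0 0): zuv; rewrite !mxE.
apply/mulIf; apply: contra u0.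
rewrite psumr_eq0 => [/allP uv0|i _]; last by rewrite !mxE mul_conjC_ge0.
apply/eqP/rowP => i; have := uv0 i (mem_index_enum _).
by rewrite !mxE mul_conjC_eq0 => /eqP.
Qed.

(** The splitting over the closed field [R[i]] descends to [R], all roots being real. *)
Lemma symmetric_char_poly_split (R : rcfType) n (L : 'M[R]_n) :
  L^T = L -> exists s : seq R, char_poly L = \prod_(z <- s) ('X - z%:P).
Proof.
move=> Lsym.
have [r Er] := closed_field_poly_normal (char_poly (map_mx (real_complex R) L)).
move: Er; rewrite (monicP (char_poly_monic _)) scale1r => Er.
exists (map (@complex.Re R) r); apply: (map_poly_inj (real_complex R)).
rewrite map_char_poly /= Er rmorph_prod big_map /= big_seq [RHS]big_seq.
apply: eq_bigr => z zr; rewrite map_polyXsubC /= RRe_real //.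
apply: (symmetric_eigenvalue_real Lsym).
by rewrite eigenvalue_root_char Er root_prod_XsubC.
Qed.

(** * Annihilation by products of linear factors of a symmetric matrix *)

Section ShiftedProducts.
Variables (R : rcfType) (n : nat) (L : 'M[R]_n).

(** This is [w] times p(L), where p is the monic polynomial with root list [s]; keeping the factors
    in a list allows induction on [s]. *)
Definition shifted (s : seq R) (w : 'rV[R]_n) : 'rV[R]_n :=
  foldr (fun z u => u *m (L - z%:M)) w s.

Lemma shiftedB s v w : shifted s (v - w) = shifted s v - shifted s w.
Proof. by elim: s => //= z s ->; rewrite mulmxBl. Qed.

Hypothesis Lsym : L^T = L.

Lemma shifted_mul_eigenvector s w (x : 'rV_n) z : x *m L = z *: x ->
  shifted s w *m x^T = (\prod_(m <- s) (z - m)) *: (w *m x^T).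
Proof.
move=> xL; elim: s => [|m s IHs] /=; first by rewrite big_nil scale1r.
rewrite big_cons -scalerA -IHs -mulmxA.
have -> : (L - m%:M) *m x^T = (x *m (L - m%:M))^T.
  by rewrite trmx_mul linearB /= Lsym tr_scalar_mx.
by rewrite mulmxBr xL mul_mx_scalar -scalerBl linearZ /= -scalemxAr.
Qed.

(* In [w (L - z_1) ... (L - z_m) = 0] the factors can be cancelled one by one:
   the product without the last factor is an eigenvector orthogonal to itself. *)
Lemma shifted_eq0 s w :
  (forall z (x : 'rV_n), x *m L = z *: x -> w *m x^T = 0) ->
  shifted s w = 0 -> w = 0.
Proof.
move=> worth; elim: s => //= m s IHs.
rewrite mulmxBr mul_mx_scalar => /eqP; rewrite subr_eq0 => /eqP uL.
apply/IHs/mul_tr_eq0.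
by rewrite (shifted_mul_eigenvector _ _ uL) (worth m) // scaler0.
Qed.

End ShiftedProducts.

Lemma shifted_char_poly (R : rcfType) n (L : 'M[R]_n) :
  L^T = L -> exists s, forall w, shifted L s w = 0.
Proof.
(* Dimension 0 is treated apart: evaluating polynomials at [L] takes place in a nontrivial matrix
   ring. *)
case: n L => [|n] L Lsym; first by exists [::] => w; apply/rowP => -[].
have [s Es] := symmetric_char_poly_split Lsym; exists s => w.
have shiftedE t : shifted L t w =
    w *m horner_mx L (\prod_(z <- rev t) ('X - z%:P)).
  elim: t => [|z t IHt] /=; first by rewrite big_nil rmorph1 mulmx1.
  rewrite IHt rev_cons -cats1 big_cat big_seq1 rmorphM /=.
  by rewrite rmorphB /= horner_mx_X horner_mx_C mulmxA.
by rewrite shiftedE (perm_big s) ?perm_rev //= -Es Cayley_Hamilton mulmx0.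
Qed.

(** Stands in for the spectral decomposition: [shifted L s w] is orthogonal to every eigenvector, by
    a zero factor if the eigenvalue is in [s] and by hypothesis otherwise, while the characteristic
    polynomial kills it. *)
Lemma shifted_support_eq0 (R : rcfType) n (L : 'M[R]_n) s w :
  L^T = L ->
  (forall z (x : 'rV_n), z \notin s -> x *m L = z *: x -> w *m x^T = 0) ->
  shifted L s w = 0.
Proof.
move=> Lsym worth; have [t t0] := shifted_char_poly Lsym.
apply: (shifted_eq0 Lsym _ (t0 _)) => z x xL.
rewrite (shifted_mul_eigenvector Lsym _ _ xL).
have [zs|zs] := boolP (z \in s); last by rewrite (worth z) ?scaler0.
by rewrite (big_rem z) //= subrr mul0r scale0r.
Qed.

(** By definiteness [U] and [kermx U^T] meet trivially, so by ranks they span everything, and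
    [v - v *m orthproj U] lies in [kermx U^T]. *)
Lemma orthproj_mul_tr (R : realType) n (U : 'M[R]_n) (v x : 'rV_n) :
  (x <= U)%MS -> v *m orthproj U *m x^T = v *m x^T.
Proof.
move=> xU.
have cap0 : (U :&: kermx U^T)%MS = 0.
  apply/eqP/rowV0P => u; rewrite sub_capmx => /andP[/submxP[y ->]].
  move=> /sub_kermxP yU; apply: mul_tr_eq0.
  by rewrite trmx_mul mulmxA yU mul0mx.
have full : row_full (U + kermx U^T)%MS.
  rewrite /row_full; have /mxdirectP /= -> := introT mxdirect_addsP cap0.
  by rewrite mxrank_ker mxrank_tr subnKC // rank_leq_row.
have /sub_kermxP compl0 := proj_mx_compl_sub (submx_full v full).
case/submxP: xU => y ->; rewrite trmx_mul; apply/eqP.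
by rewrite eq_sym -subr_eq0 -mulmxBl mulmxA compl0 mul0mx.
Qed.

(** * Walks and distances *)

Section Walks.
Variables (T : finType) (e : rel T).

Lemma walk_cat x y z m n : walk e x y m -> walk e y z n -> walk e x z (m + n).
Proof.
move=> [p [ep <- <-]] [q [eq <- <-]]; exists (p ++ q).
by rewrite cat_path ep last_cat size_cat.
Qed.

Lemma walk_sym x y n : symmetric e -> walk e x y n -> walk e y x n.
Proof.
move=> e_sym [p [ep <- <-]]; exists (rev (belast x p)).
rewrite rev_path size_rev size_belast; split=> //.
  by rewrite (eq_path (e' := e)) // => u v; rewrite e_sym.
by case: p {ep} => // y' p; rewrite rev_cons last_rcons.
Qed.

Lemma walk_rcons x z n :
  walk e x z n.+1 <-> exists2 y, walk e x y n & e y z.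
Proof.
split=> [[p]|[y [p [ep <- <-]] eyz]].
  case/lastP: p => [|p y] [] //; rewrite rcons_path last_rcons size_rcons.
  by move=> /andP[ep ey] <- [<-]; exists (last x p) => //; exists p.
by exists (rcons p z); rewrite rcons_path ep last_rcons size_rcons.
Qed.

Lemma dist_le_walk x y m k : walk e x y m -> (m <= k)%N -> dist_le e x y k.
Proof.
move=> wm mk; have exw : exists n, `[< walk e x y n >] by exists m; apply/asboolP.
case: (ex_minnP exw) => d /asboolP wd dmin; exists d.
  by split=> // j /asboolP; apply: dmin.
by apply: leq_trans mk; apply/dmin/asboolP.
Qed.

Lemma dist_prefix x y d k : dist e x y d -> (k <= d)%N ->
  exists z, dist e x z k /\ walk e z y (d - k).
Proof.
move=> [[p [ep lp sp]] dmin] kd.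
exists (last x (take k p)).
move: ep; rewrite -{1}(cat_take_drop k p) cat_path => /andP[ek ed].
have wzy : walk e (last x (take k p)) y (d - k).
  by exists (drop k p); rewrite size_drop sp -last_cat cat_take_drop.
split=> //; split=> [|m wm].
  by exists (take k p); rewrite size_takel ?sp.
(* A walk to the intermediate vertex shorter than [k] would shorten the geodesic. *)
by have := dmin _ (walk_cat wm wzy); rewrite addnC -leq_subLR subKn.
Qed.

End Walks.

(** * Entries of Laplacian polynomials, and strong cospectrality *)

Section Laplacian.
Variables (R : realType) (T : finType) (e : rel T).
Hypotheses (e_sym : symmetric e) (e_irr : irreflexive e).

Local Notation L := (laplacian e R).
Local Notation vec := (vertex_vec R).

Lemma laplacian_sym : L^T = L.
Proof.
rewrite /laplacian linearB /= tr_diag_mx; congr (_ - _).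
by apply/matrixP => i j; rewrite !mxE e_sym.
Qed.

Lemma laplacian_offdiag i j :
  i != j -> L i j = - (e (enum_val i) (enum_val j))%:R.
Proof. by move=> ij; rewrite !mxE (negPf ij) mulr0n sub0r. Qed.

(** Each factor [L - z%:M] is supported on the diagonal and the edges, so it either stays in place
    or takes one step. *)
Lemma shifted_laplacian_walk s x y :
  shifted L s (vec x) 0 (enum_rank y) != 0 ->
  exists2 m, (m <= size s)%N & walk e x y m.
Proof.
elim: s y => [|z s IHs] y /=.
  rewrite mxE eqxx /= pnatr_eq0 eqb0 negbK => /eqP/enum_rank_inj <-.
  by exists 0%N => //; exists [::].
set u := shifted L s (vec x) in IHs *.
rewrite mxE => sum_neq0.
have /existsP[j] : [exists j, u 0 j * (L - z%:M) j (enum_rank y) != 0].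
  apply: contraR sum_neq0; rewrite negb_exists => /forallP all0.
  by rewrite big1 // => j _; apply/eqP; rewrite -[_ == _]negbK all0.
rewrite mulf_eq0 negb_or -{1 2}(enum_valK j) => /andP[/IHs[m ms wm]].
have [<- _|jy] := eqVneq (enum_val j) y; first by exists m => //; apply: leqW.
have jy' : j != enum_rank y by apply: contraNneq jy => ->; rewrite enum_rankK.
rewrite enum_valK [X in X != 0]mxE laplacian_offdiag // !mxE (negPf jy').
rewrite mulr0n subr0 oppr_eq0 pnatr_eq0 eqb0 negbK enum_rankK => ejy.
by exists m.+1 => //; apply/walk_rcons; exists (enum_val j).
Qed.

(* When no shorter walk exists, the diagonal of [L - z] never contributes, so
   the entry is [(-1) ^+ size s] times the number of walks of length [size s]. *)
Lemma shifted_laplacian_entry s x y :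
  (forall m, (m < size s)%N -> ~ walk e x y m) ->
  0 <= (-1) ^+ size s * shifted L s (vec x) 0 (enum_rank y) /\
  (walk e x y (size s) ->
   0 < (-1) ^+ size s * shifted L s (vec x) 0 (enum_rank y)).
Proof.
elim: s y => [|z s IHs] y nowalk /=.
  rewrite expr0 mul1r mxE eqxx /=; split; first exact: ler0n.
  by case=> p [_ lp sp]; rewrite -lp (size0nil sp) /= eqxx.
have uy0 : shifted L s (vec x) 0 (enum_rank y) = 0.
  apply/eqP; apply/negPn/negP => /shifted_laplacian_walk[m ms].
  exact: nowalk.
set u := shifted L s (vec x) in IHs uy0 *.
(* The signed contribution of walks whose last step goes from [w] to [y]; the entry -1 of [L] at an
   edge accounts for the extra sign. *)
pose f w := (-1) ^+ size s * u 0 (enum_rank w) * (e w y)%:R.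
have f_ge0 w : 0 <= f w.
  rewrite /f; case ewy: (e w y); last by rewrite mulr0.
  rewrite mulr1; apply: (IHs w _).1 => m ms wm.
  by apply: (nowalk m.+1 ms); apply/walk_rcons; exists w.
have -> : (-1) ^+ (size s).+1 * (u *m (L - z%:M)) 0 (enum_rank y) = \sum_w f w.
  rewrite mxE (reindex _ (onW_bij _ (@enum_rank_bij T))) /= mulr_sumr.
  apply: eq_bigr => w _; rewrite /f.
  have [->|wy] := eqVneq w y; first by rewrite uy0 e_irr !(mul0r, mulr0).
  have wy' : enum_rank w != enum_rank y by rewrite (inj_eq enum_rank_inj).
  rewrite [(L - _) _ _]mxE laplacian_offdiag // !mxE (negPf wy') !enum_rankK.
  by rewrite mulr0n subr0 exprS mulN1r mulrN mulrNN mulrA.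
split; first exact: sumr_ge0.
move=> /walk_rcons[w wxw ewy]; rewrite (bigD1 w) //=.
apply: ltr_wpDr; first exact: sumr_ge0.
rewrite /f ewy mulr1; apply: (IHs w _).2 => // m ms wm.
by apply: (nowalk m.+1 ms); apply/walk_rcons; exists w.
Qed.

Lemma vec_mul_tr x (u : 'rV_#|T|) : vec x *m u^T = (u 0 (enum_rank x))%:M.
Proof.
by rewrite -rowE; apply/matrixP => i j; rewrite !ord1 !mxE eqxx mulr1n.
Qed.

Lemma strongly_cospectral_connect a b :
  laplacian_strongly_cospectral e R a b -> connect e a b.
Proof.
(* The indicator of the component of [a] lies in the kernel of [L]. With [b] outside, its product
   with [vec b] is 0, hence so is that with [vec a], which is 1. *)
move=> ab; pose u : 'rV[R]_#|T| := \row_j (connect e a (enum_val j))%:R.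
have ua : u 0 (enum_rank a) = 1 by rewrite mxE enum_rankK connect0.
have uL : u *m L = 0 *: u.
  rewrite scale0r mulmxBr mul_mx_diag; apply/rowP => j; rewrite !mxE.
  apply/eqP; rewrite subr_eq0; apply/eqP.
  rewrite -sum1_card natr_sum mulr_sumr.
  rewrite (reindex _ (onW_bij _ (@enum_rank_bij T))) /= big_mkcond /=.
  apply: eq_bigr => w _; rewrite !mxE inE enum_rankK mulr1 e_sym.
  case: ifP => [ewj|_]; last by rewrite mulr0.
  rewrite mulr1; congr ((nat_of_bool _)%:R).
  apply/idP/idP => /connect_trans; apply; apply: connect1 => //.
  by rewrite e_sym.
have u0 : u != 0.
  apply/eqP => /rowP/(_ (enum_rank a)).
  by rewrite ua mxE => /eqP; rewrite oner_eq0.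
have uE : (u <= eigenspace L 0)%MS by apply/eigenspaceP.
have ev0 : eigenvalue L 0 by apply/eigenvalueP; exists u.
apply: contraT => ncon.
have ub : u 0 (enum_rank b) = 0 by rewrite mxE enum_rankK (negPf ncon).
have : vec a *m u^T = 0.
  rewrite -(orthproj_mul_tr _ uE) -/(eigenproj _ _ _).
  have b0 : vec b *m eigenproj e 0 *m u^T = 0.
    by rewrite orthproj_mul_tr // vec_mul_tr ub raddf0.
  by case: (ab _ ev0) => ->; rewrite ?mulNmx b0 ?oppr0.
rewrite vec_mul_tr ua => /matrixP/(_ 0 0); rewrite !mxE eqxx => /eqP.
by rewrite mulr1n oner_eq0.
Qed.

Lemma shifted_Phi_minus a b s :
  laplacian_strongly_cospectral e R a b ->
  (Phi_minus e a b `<=` [set` s])%classic ->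
  shifted L s (vec a) = shifted L s (vec b).
Proof.
move=> ab sPhi; apply/eqP; rewrite -subr_eq0 -shiftedB; apply/eqP.
apply: (shifted_support_eq0 laplacian_sym) => z x zs xL.
have xE : (x <= eigenspace L z)%MS by apply/eigenspaceP.
have [->|x0] := eqVneq x 0; first by rewrite trmx0 mulmx0.
have evz : eigenvalue L z by apply/eigenvalueP; exists x.
rewrite -(orthproj_mul_tr _ xE) -/(eigenproj _ _ _) mulmxBl.
(* Equal projections cancel; opposite ones must vanish, since [z] is outside [Phi_minus]. *)
case: (ab _ evz) => [->|abN]; first by rewrite subrr mul0mx.
have [a0|a0] := eqVneq (vec a *m eigenproj e z) 0; last first.
  by case/negP: zs; apply: sPhi.
by move/eqP: abN; rewrite a0 eq_sym oppr_eq0 => /eqP ->; rewrite subrr mul0mx.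
Qed.

End Laplacian.

Theorem theorem6p7 (R : realType) (T : finType) (e : rel T)
    (e_sym : symmetric e) (e_irr : irreflexive e) (a b : T) (k : nat)
    (ab_cosp : laplacian_strongly_cospectral e R a b)
    (card_Phi : ((Phi_minus e a b : set R) #= `I_k)%card) :
  (forall c : T, dist e a c k -> dist_le e b c k) /\ dist_le e a b (2 * k)%N.
Proof.
have [s sk Phis] : exists2 s : seq R, size s = k &
    (Phi_minus e a b `<=` [set` s])%classic.
  case/card_set_bijP: card_Phi => f [fk finj _].
  (* A partial inverse of [f]; the default 0 is harmless, since [s] only has to contain [Phi_minus]
     and have length [k]. *)
  pose g i := xget 0 [set z | Phi_minus e a b z /\ f z = i]%classic.
  exists (map g (iota 0 k)); first by rewrite size_map size_iota.
  move=> z Phiz.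
  have [Phig fg] : Phi_minus e a b (g (f z)) /\ f (g (f z)) = f z.
    by apply: (@xgetPex _ 0 [set y | _ y /\ f y = f z]%classic); exists z.
  rewrite -(finj _ _ (mem_set Phig) (mem_set Phiz) fg).
  by apply/map_f; rewrite mem_iota; apply: fk.
have near c : dist e a c k -> dist_le e b c k.
  case=> wac amin.
  have [|_] := @shifted_laplacian_entry R T e e_irr s a c.
    by move=> m; rewrite sk => mk /amin; rewrite leqNgt mk.
  (* The nonzero entry at [c] of the row started at [a] is also that of the row started at [b]. *)
  rewrite sk (shifted_Phi_minus e_sym ab_cosp Phis) => /(_ wac) /lt0r_neq0.
  rewrite mulf_eq0 negb_or => /andP[_ /shifted_laplacian_walk[m]].
  by rewrite sk => mk wm; apply: dist_le_walk wm mk.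
split=> //; have /connectP[p ep lp] := strongly_cospectral_connect e_sym ab_cosp.
have wp : walk e a b (size p) by exists p.
have [d dab _] := dist_le_walk wp (leqnn _).
have [dk|/ltnW kd] := leqP d k.
  by exists d => //; rewrite mul2n -addnn (leq_trans dk) ?leq_addr.
have [c [dac _]] := dist_prefix dab kd.
have [j [wbc _] jk] := near c dac.
apply: (dist_le_walk (walk_cat dac.1 (walk_sym e_sym wbc))).
by rewrite mul2n -addnn leq_add2l.
Qed.
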